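(* There exist a group $\Gamma$, an action of $\Gamma$ on a Polish space $X$ by Borel automorphisms, and Borel sets $B_0,B_1\subset X$ such that $B_0$ and $B_1$ are equidecomposable with respect to this action, but are not equidecomposable using pieces with the Baire property.
   Context: An action is by Borel automorphisms if each map $x\mapsto\gamma\cdot x$ is Borel. Sets $A,B\subset X$ are equidecomposable with respect to an action of $\Gamma$ if there is a partition $\{A_1,\ldots,A_n\}$ of $A$ into finitely many sets and $\alpha_1,\ldots,\alpha_n\in\Gamma$ such that the sets $\alpha_iA_i$ are pairwise disjoint and $B=\alpha_1A_1\cup\cdots\cup\alpha_nA_n$; they are equidecomposable using pieces with the Baire property if this can be done with each $A_i$ having the Baire property. *)

(* Defs.v *)
From mathcomp Require Import all_boot all_order all_algebra.
From mathcomp Require Import all_classical all_reals all_analysis.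
Set Implicit Arguments.
Unset Strict Implicit.
Unset Printing Implicit Defensive.

Import Order.TTheory GRing.Theory Num.Theory.
Local Open Scope classical_set_scope.

Definition separable (T : topologicalType) : Prop :=
  exists2 D : set T, countable D & dense D.

Definition is_metric (R : realType) (T : Type) (d : T -> T -> R) : Prop :=
  [/\ forall x y, (0 <= d x y)%R,
      forall x y, d x y = 0%R <-> x = y,
      forall x y, d x y = d y x &
      forall x y z, (d x z <= d x y + d y z)%R].

Definition metric_compatible (R : realType) (T : topologicalType)
    (d : T -> T -> R) : Prop :=
  forall (x : T) (A : set T),
    nbhs x A <-> exists2 e : R, (0 < e)%R & [set y | (d x y < e)%R] `<=` A.

Definition metric_complete (R : realType) (T : topologicalType)
    (d : T -> T -> R) : Prop :=
  forall u : nat -> T,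
    (forall e : R, (0 < e)%R -> exists N : nat,
       forall m n : nat, N <= m -> N <= n -> (d (u m) (u n) < e)%R) ->
    exists l : T, u @ \oo --> l.

(* Completeness is expressed with convergence in the topology of [T], which
   is that of [d] by [metric_compatible]. *)
Definition polish (R : realType) (T : topologicalType) : Prop :=
  separable T /\
  exists d : T -> T -> R,
    [/\ is_metric d, metric_compatible d & metric_complete d].

(* No point of [T] is required, whereas the measurableType instance on
   [g_sigma_algebraType open] asks for a pointedType. *)
Definition borel (T : topologicalType) : set (set T) := <<s @open T >>.

Definition borel_map (T U : topologicalType) (f : T -> U) : Prop :=
  forall B : set U, borel B -> borel (f @^-1` B).

Definition nowhere_dense (T : topologicalType) (A : set T) : Prop :=
  interior (closure A) = set0.

Definition meager (T : topologicalType) (A : set T) : Prop :=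
  exists2 F : nat -> set T,
    forall n, nowhere_dense (F n) & A = \bigcup_n F n.

Definition baire_property (T : topologicalType) (A : set T) : Prop :=
  exists2 U : set T, open U & meager (A `+` U).

(* [groupType] is the type of arbitrary, possibly infinite, groups; the
   [is_action] of MathComp is restricted to finite ones. *)
Definition left_action (G : groupType) (X : Type) (act : G -> X -> X) : Prop :=
  (forall x, act 1%g x = x) /\
  (forall g h x, act (g * h)%g x = act g (act h x)).

Definition acts_by_borel_automorphisms (G : groupType) (X : topologicalType)
    (act : G -> X -> X) : Prop :=
  left_action act /\ forall g, borel_map (act g).

(* [P] is the class of sets allowed as pieces; [partition] also requires the
   pieces to be nonempty, and [n = 0] is the case of the empty set. *)
Definition equidecomposable_using (G : groupType) (X : Type)
    (act : G -> X -> X) (P : set (set X)) (A B : set X) : Prop :=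
  exists (n : nat) (A_ : 'I_n -> set X) (alpha : 'I_n -> G),
    [/\ partition [set: 'I_n] A_ A,
        forall i, P (A_ i),
        trivIset [set: 'I_n] (fun i => act (alpha i) @` A_ i) &
        B = \bigcup_i (act (alpha i) @` A_ i)].

Definition equidecomposable (G : groupType) (X : Type)
    (act : G -> X -> X) (A B : set X) : Prop :=
  equidecomposable_using act setT A B.

Definition equidecomposable_baire (G : groupType) (X : topologicalType)
    (act : G -> X -> X) (A B : set X) : Prop :=
  equidecomposable_using act (@baire_property X) A B.

(* Main.v *)
(* Let D = <a, b> be the infinite dihedral group acting on the circle R/Z by
   a x = - x and b x = alpha - x with Z + Z alpha dense; b a is the rotation by
   alpha.  The half circles B0 = (0, 1/2) and B1 = (alpha/2, (alpha+1)/2),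
   minus the countably many points with 2 x in Z + Z alpha, contain exactly one
   point of each pair {x, a x}, resp. {x, b x}.  Orienting every D-orbit by
   choice yields a set M which is such a transversal for a and b at once, and
   B0 -> M -> B1 is an equidecomposition with multipliers 1, a, b, b a.

   Let phi |-> phi(x) (+) phi(-x) fold a bool-valued function.  For every g in D
   the folds of phi and of phi o g differ by the fold of some psi with
   psi(- x - alpha) = psi(x), which has the Baire property if phi has it.  Hence
   an equidecomposition of B0 to B1 with Baire pieces gives such a psi for their
   indicator functions, and psi(x) (+) 1_B1(x + alpha) is, off a countable set,
   invariant under the rotation by alpha but complemented by the reflection
   - x - alpha, which contradicts generic ergodicity of the rotation.

   The circle is identified with [0, 1) inside the Polish space R, where the
   action is by Borel automorphisms; pieces are lifted to periodic subsets of R,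
   on which D acts by affine homeomorphisms. *)
Require Import Defs.
From HB Require Import structures.
From mathcomp Require Import all_boot all_order all_algebra.
From mathcomp Require Import all_classical all_reals all_analysis.
From mathcomp Require Import measurable_realfun.
From mathcomp Require Import ring lra.
Set Implicit Arguments.
Unset Strict Implicit.
Unset Printing Implicit Defensive.

Import Order.TTheory GRing.Theory Num.Theory.
Import numFieldNormedType.Exports.
Local Open Scope classical_set_scope.
Local Open Scope ring_scope.

(** * Baire category *)

Section Category.
Variable T : topologicalType.
Implicit Types A B U V : set T.

(** Free of closures, so that it passes directly to subsets and along homeomorphisms. *)
Lemma nowhere_denseP A :
  nowhere_dense A <->
  forall U, open U -> U !=set0 ->
    exists V, [/\ open V, V !=set0, V `<=` U & V `&` A = set0].
Proof.
split=> [nA U oU U0|H].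
- exists (U `&` ~` closure A); split.
  + by apply: openI => //; rewrite openC; exact: closed_closure.
  + apply: contrapT => UA.
    have UcA : U `<=` closure A.
      by move=> x Ux; apply: contrapT => xA; apply: UA; exists x.
    have [x Ux] := U0.
    have : interior (closure A) x.
      by apply: filterS UcA _; exact: open_nbhs_nbhs.
    by rewrite nA.
  + by move=> x [].
  + by apply/seteqP; split=> [x [[_ xA] /subset_closure]|x []//].
- apply/seteqP; split=> [x xA|x []//].
  have [||V [oV [y Vy] VU VA]] := H (interior (closure A)).
  + exact: open_interior.
  + by exists x.
  + have yA : closure A y by apply: interior_subset; apply: VU.
    have [z [Az Vz]] := yA V (open_nbhs_nbhs (conj oV Vy)).
    by have : (V `&` A) z by []; rewrite VA.
Qed.

Lemma sub_nowhere_dense A B : A `<=` B -> nowhere_dense B -> nowhere_dense A.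
Proof.
move=> AB /nowhere_denseP nB; apply/nowhere_denseP => U oU U0.
have [V [oV V0 VU VB]] := nB U oU U0; exists V; split=> //.
by apply/seteqP; split=> [x [Vx Ax]|x []//]; rewrite -VB; split=> //; exact: AB.
Qed.

Lemma meager0 : meager (@set0 T).
Proof.
exists (fun=> set0); last by rewrite bigcup0.
move=> n; apply/nowhere_denseP => V oV V0.
by exists V; split=> //; rewrite setI0.
Qed.

Lemma sub_meager A B : A `<=` B -> meager B -> meager A.
Proof.
move=> AB [F nF BF]; exists (fun n => F n `&` A).
  by move=> n; apply: sub_nowhere_dense (nF n) => x [].
apply/seteqP; split=> [x Ax|x [n _ []]//].
by have := AB _ Ax; rewrite BF => -[n _ Fx]; exists n.
Qed.

Lemma meagerU A B : meager A -> meager B -> meager (A `|` B).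
Proof.
move=> [F nF ->] [G nG ->].
exists (fun n => if odd n then F n./2 else G n./2).
  by move=> n; case: ifP.
apply/seteqP; split=> x.
- case=> - [n _ H]; first by exists n.*2.+1 => //=; rewrite odd_double /= uphalf_double.
  by exists n.*2 => //=; rewrite odd_double doubleK.
- case=> n _; case: ifP => _ H; [left|right]; by exists n./2.
Qed.

(* A weakening of the Baire property whose closure under (+) and periodisation
   needs neither boundaries of open sets nor countable unions. *)
Definition locally_decided (E : T -> bool) :=
  forall U, open U -> U !=set0 -> exists V, [/\ open V, V !=set0, V `<=` U &
    exists b, meager [set x | V x /\ E x = b]].

(** If [U] meets the approximating open set [G], the complement of [A] is meager inside both; if
    not, [A] is meager inside [U]. *)
Lemma baire_property_locally_decided A :
  baire_property A -> locally_decided (fun x => `[< A x >]).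
Proof.
move=> [G oG mAG] U oU U0.
have [UO|UO] := pselect (U `&` G !=set0).
- exists (U `&` G); split=> //; first exact: openI.
  exists false; apply: sub_meager mAG => x [[Ux Ox]] /asboolPn nA.
  by right; split.
- exists U; split=> //; exists true; apply: sub_meager mAG => x [Ux] /asboolP Ax.
  by left; split=> // Gx; apply: UO; exists x.
Qed.

Lemma locally_decided_addb (E F : T -> bool) :
  locally_decided E -> locally_decided F ->
  locally_decided (fun x => E x (+) F x).
Proof.
move=> dE dF U oU /(dE _ oU) [V [oV /(dF _ oV) [W [oW W0 WV [c mc]]] VU [b mb]]].
exists W; split=> //; first exact: subset_trans WV VU.
(* [b] and [c] are the rare values, so the sum is generically [~~ b (+) ~~ c], that is [b (+) c]. *)
exists (~~ (b (+) c)); apply: sub_meager (meagerU mb mc) => x [Wx Exy].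
have := Exy; case: (E x =P b) => [Eb _|Eb]; first by left; split=> //; exact: WV.
case: (F x =P c) => [Fc _|Fc]; first by right.
by move: Eb Fc; case: (E x) (F x) b c {mb mc Exy} => -[] [] [].
Qed.

Lemma locally_decided_cst b : locally_decided (fun=> b).
Proof.
move=> U oU U0; exists U; split=> //; exists (~~ b).
by apply: sub_meager meager0 => x [_]; case: b.
Qed.

End Category.

(** * Category under homeomorphisms *)

Section CategoryHomeo.
Variables (T : topologicalType) (f g : T -> T).
Hypotheses (fK : cancel f g) (gK : cancel g f).
Hypotheses (cf : continuous f) (cg : continuous g).

Let openf U : open U -> open (f @^-1` U).
Proof. by move=> oU; apply: open_comp => // x _; exact: cf. Qed.

Let openg U : open U -> open (g @^-1` U).
Proof. by move=> oU; apply: open_comp => // x _; exact: cg. Qed.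

Lemma nowhere_dense_preimage A : nowhere_dense A -> nowhere_dense (f @^-1` A).
Proof.
move=> /nowhere_denseP nA; apply/nowhere_denseP => U oU [x Ux].
have [|V [oV [y Vy] VU VA]] := nA _ (openg oU); first by exists (f x); rewrite /= fK.
exists (f @^-1` V); split.
- exact: openf.
- by exists (g y); rewrite /= gK.
- by move=> z /VU; rewrite /= fK.
- by rewrite -preimage_setI VA preimage_set0.
Qed.

Lemma meager_preimage A : meager A -> meager (f @^-1` A).
Proof.
move=> [F nF ->]; exists (fun n => f @^-1` F n).
  by move=> n; exact: nowhere_dense_preimage.
by rewrite preimage_bigcup.
Qed.

Lemma locally_decided_comp E : locally_decided E -> locally_decided (E \o f).
Proof.
move=> dE U oU [x Ux].
have [|V [oV [y Vy] VU [b mb]]] := dE _ (openg oU); first by exists (f x); rewrite /= fK.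
exists (f @^-1` V); split.
- exact: openf.
- by exists (g y); rewrite /= gK.
- by move=> z /VU; rewrite /= fK.
- by exists b; exact: (meager_preimage mb).
Qed.

End CategoryHomeo.

(** * Meager sets of reals *)

Section RealCategory.
Variable R : realType.

(** Baire's theorem for the dense open complements of the closures of the [F n]. *)
Lemma meager_not_open (W : set R) : open W -> W !=set0 -> ~ meager W.
Proof.
move=> oW W0 [F nF WF].
have [|x [Wx Hx]] := @Baire R R (fun n => ~` closure (F n)) _ W W0 oW.
  move=> n; split; first by rewrite openC; exact: closed_closure.
  move=> U U0 oU; have /nowhere_denseP/(_ U oU U0)[V [oV [y Vy] VU VF]] := nF n.
  exists y; split; first exact: VU.
  move=> yF; have [z [Fz Vz]] := yF V (open_nbhs_nbhs (conj oV Vy)).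
  by have : (V `&` F n) z by []; rewrite VF.
move: Wx; rewrite WF => -[n _ /subset_closure]; exact: Hx.
Qed.

Lemma countable_meager (A : set R) : countable A -> meager A.
Proof.
have [->|A0] := eqVneq A set0.
  by move=> _; exact: meager0.
move/pfcard_geP => [A1|[f]]; first by rewrite A1 eqxx in A0.
exists (fun n => [set f n]); last first.
  apply/seteqP; split=> x.
    by move=> /(@surj _ _ _ _ f) [n _ <-]; exists n.
  by move=> [n _ ->]; exact: funS.
move=> n; apply/nowhere_denseP => U oU [x Ux].
have [e /= e0 He] : exists2 e : R, 0 < e & ball x e `<=` U.
  by move: oU; rewrite openE => /(_ _ Ux)/nbhs_ballP[e e0 He]; exists e.
(* No point is isolated: if the centre is [f n], a quarter of the radius leads away from it inside
   the ball. *)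
have [y yf By] : exists2 y, y != f n & ball x e y.
  have [xf|xf] := eqVneq x (f n); last by exists x => //; apply: ballxx.
  have e0' : 0 < e := e0.
  exists (x + e / 4); first by rewrite -xf; apply/eqP; lra.
  rewrite -ball_normE /=.
  have -> : x - (x + e / 4) = - (e / 4) by ring.
  by rewrite normrN gtr0_norm; lra.
have Uy : U y by exact: He.
exists (U `&` ~` [set f n]); split.
- by apply: openI => //; rewrite openC; exact: closed_eq.
- by exists y; split=> //; apply/eqP.
- by move=> z [].
- by apply/seteqP; split=> [z [[_ H1] H2]//|z []//].
Qed.

End RealCategory.

(** * The dihedral action *)

(* [(e, n)] stands for x |-> (-1)^e x + n alpha. *)
Definition dihedral : Type := (bool * int)%type.
HB.instance Definition _ := Choice.on dihedral.

Definition dihedral_mul (g h : dihedral) : dihedral :=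
  (g.1 (+) h.1, g.2 + (-1) ^+ g.1 * h.2).
Definition dihedral_inv (g : dihedral) : dihedral := (g.1, - (-1) ^+ g.1 * g.2).

Lemma dihedral_mulA : associative dihedral_mul.
Proof.
move=> [a m] [b n] [c p]; rewrite /dihedral_mul /= addbA signr_addb.
by congr pair; ring.
Qed.

Lemma dihedral_mul1 : left_id (false, 0) dihedral_mul.
Proof. by move=> [a m]; rewrite /dihedral_mul /= expr0 mul1r add0r. Qed.

Lemma dihedral_mulr1 : right_id (false, 0) dihedral_mul.
Proof. by move=> [a m]; rewrite /dihedral_mul /= addbF mulr0 addr0. Qed.

Lemma dihedral_mulV : left_inverse (false, 0) dihedral_inv dihedral_mul.
Proof.
by move=> [a m]; rewrite /dihedral_mul /dihedral_inv /= addbb; congr pair; ring.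
Qed.

Lemma dihedral_mulrV : right_inverse (false, 0) dihedral_inv dihedral_mul.
Proof.
move=> [a m]; rewrite /dihedral_mul /dihedral_inv /= addbb; congr pair.
by case: a => /=; ring.
Qed.

HB.instance Definition _ := isGroup.Build dihedral dihedral_mulA dihedral_mul1
  dihedral_mulr1 dihedral_mulV dihedral_mulrV.

Section Action.
Variable R : realType.
Implicit Types (x y : R) (g h : dihedral) (m n : int).

(* The powers of this number lie in Z + Z alpha and tend to 0, whence the
   density of Z + Z alpha. *)
Definition alpha : R := Num.sqrt 2 - 1.

Lemma alpha_sqr : alpha * alpha = 1 - 2 * alpha.
Proof.
have : Num.sqrt 2 ^+ 2 = 2 :> R by rewrite sqr_sqrtr.
by rewrite /alpha expr2 => H; ring: H.
Qed.

Lemma alpha_gt0 : 0 < alpha.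
Proof. by rewrite subr_gt0 -[X in X < _]sqrtr1 ltr_sqrt; lra. Qed.

Lemma alpha_lt_half : alpha < 1 / 2.
Proof. by have := alpha_gt0; have := alpha_sqr; nra. Qed.

Lemma alpha_exp k : exists m n, alpha ^+ k = m%:~R + n%:~R * alpha.
Proof.
elim: k => [|k [m [n IH]]]; first by exists 1, 0; rewrite expr0 mul0r addr0.
(* By [alpha_sqr], (m + n alpha) alpha = n + (m - 2 n) alpha. *)
exists n, (m - 2 * n); rewrite exprSr IH mulrDl -mulrA alpha_sqr.
by rewrite intrB intrM; ring.
Qed.

Lemma alpha_exp_small (e : R) : 0 < e -> exists k, alpha ^+ k < e.
Proof.
move=> e0.
have /cvgr0_norm_lt/(_ _ e0)[k _ Hk] : GRing.exp alpha @ \oo --> (0 : R).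
  apply: cvg_expr; rewrite gtr0_norm ?alpha_gt0//.
  by have := alpha_lt_half; lra.
by exists k; apply: le_lt_trans (ler_norm _) (Hk k (leqnn k)).
Qed.

Lemma alpha_dense (e t : R) : 0 < e ->
  exists m n, `|t - (m%:~R + n%:~R * alpha)| < e.
Proof.
move=> e0; have [k Hk] := alpha_exp_small e0.
have b0 : 0 < alpha ^+ k by rewrite exprn_gt0// alpha_gt0.
have [m [n mn]] := alpha_exp k; set b := alpha ^+ k in Hk b0 mn.
(* Rounding [t] down to a multiple of [b] leaves an error below [b]. *)
set f := Num.floor (t / b); exists (f * m), (f * n).
rewrite !intrM -mulrA -mulrDr -mn.
have /andP[H1 H2] := floor_itv (t / b).
rewrite ler_pdivlMr// in H1; rewrite ltr_pdivrMr// intrD in H2.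
by rewrite ger0_norm ?subr_ge0//; rewrite -/f mulrDl in H1 H2 *; lra.
Qed.

Definition frac x : R := x - (Num.floor x)%:~R.

Lemma frac_itv x : 0 <= frac x < 1.
Proof.
by have /andP[H1 H2] := floor_itv x; rewrite intrD in H2; rewrite /frac; lra.
Qed.

Lemma fracDz x m : frac (x + m%:~R) = frac x.
Proof. by rewrite /frac floorDrz ?intr_int// intrKfloor intrD; ring. Qed.

Lemma frac_id x : 0 <= x < 1 -> frac x = x.
Proof.
by move=> x01; rewrite /frac (@floor_def _ _ 0) ?subr0// add0r.
Qed.

Lemma fracE x : exists m, frac x = x + m%:~R.
Proof. by exists (- Num.floor x); rewrite intrN. Qed.

Lemma floor_Dfrac m x : Num.floor (m%:~R + frac x) = m.
Proof. by apply: floor_def; have := frac_itv x; rewrite intrD; lra. Qed.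

Definition affine g x : R := (-1) ^+ g.1 * x + g.2%:~R * alpha.

Lemma affine1 x : affine 1%g x = x.
Proof. by rewrite /affine /= expr0; ring. Qed.

Lemma affineM g h x : affine (g * h)%g x = affine g (affine h x).
Proof.
by case: g h => [a m] [b n]; rewrite /affine /= signr_addb intrD intrM intr_sign; ring.
Qed.

Lemma affineK g : cancel (affine g) (affine g^-1%g).
Proof. by move=> x; rewrite -affineM mulVg affine1. Qed.

Lemma affineVK g : cancel (affine g^-1%g) (affine g).
Proof. by move=> x; rewrite -affineM mulgV affine1. Qed.

Lemma affine_continuous g : continuous (affine g).
Proof.
by move=> x; apply: cvgD; [apply: cvgMr; exact: cvg_id|exact: cvg_cst].
Qed.

Lemma affineDz g x m : affine g (x + m%:~R) = affine g x + ((-1) ^+ g.1 * m)%:~R.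
Proof. by rewrite /affine intrM intr_sign; ring. Qed.

(** Affine maps carry integer translations to integer translations, so they descend to the
    circle. *)
Lemma frac_affine_frac g x : frac (affine g (frac x)) = frac (affine g x).
Proof. by have [m ->] := fracE x; rewrite affineDz fracDz. Qed.

(* The circle action, copied on every interval [m, m + 1). *)
Definition act g x : R := (Num.floor x)%:~R + frac (affine g x).

Lemma actE g x : 0 <= x < 1 -> act g x = frac (affine g x).
Proof. by move=> x01; rewrite /act (@floor_def _ _ 0) ?add0r. Qed.

Lemma act_itv g x : 0 <= x < 1 -> 0 <= act g x < 1.
Proof. by move=> x01; rewrite actE//; exact: frac_itv. Qed.

Lemma act1 x : act 1%g x = x.
Proof. by rewrite /act affine1 /frac; ring. Qed.

Lemma actM g h x : act (g * h)%g x = act g (act h x).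
Proof.
rewrite /act floor_Dfrac affineM; congr +%R.
by rewrite [(_ + frac _) in RHS]addrC affineDz fracDz frac_affine_frac.
Qed.

Lemma act_left_action : left_action act.
Proof. by split; [exact: act1|exact: actM]. Qed.

Lemma borelE : @borel R = measurable.
Proof.
apply/seteqP; split.
- apply: smallest_sub; first exact: sigma_algebra_measurable.
  exact: open_measurable.
- have -> : @measurable _ R = (@RGenOpens.G R).-sigma.-measurable.
    exact: RGenOpens.measurableE.
  apply: smallest_sub; first exact: smallest_sigma_algebra.
  move=> _ [x [y ->]]; apply: sub_sigma_algebra; exact: interval_open.
Qed.

(** [act g] may jump, but is built from a continuous map and the monotone floor. *)
Lemma act_borel g : borel_map (act g).
Proof.
move=> B; rewrite borelE => mB; rewrite -[X in measurable X]setTI.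
have mfloor : measurable_fun [set: R] (fun x => (Num.floor x)%:~R : R).
  apply: nondecreasing_measurable => // x y xy.
  by rewrite ler_int; exact: le_floor.
have maff : measurable_fun [set: R] (affine g).
  exact: (continuous_measurable_fun (@affine_continuous g)).
suff : measurable_fun [set: R] (act g) by apply.
apply: measurable_funD => //; apply: measurable_funB => //.
exact: measurableT_comp mfloor maff.
Qed.

Lemma act_borel_automorphisms : acts_by_borel_automorphisms act.
Proof. by split; [exact: act_left_action|exact: act_borel]. Qed.

Lemma real_polish : polish R R.
Proof.
split.
  exists (@ratr R @` setT); last exact: dense_rat.
  apply: sub_countable (countableP [set: rat]); exact: card_image_le.
exists (fun x y => `|x - y|); split.
- split=> [x y|x y|x y|x y z]; first exact: normr_ge0.
  + by split=> [/eqP|->]; rewrite ?subrr ?normr0// normr_eq0 subr_eq0 => /eqP.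
  + exact: distrC.
  + exact: ler_distD.
- move=> x A; split=> [/nbhs_ballP[e e0 He]|[e e0 He]]; last first.
    by apply/nbhs_ballP; exists e => // y; rewrite -ball_normE; exact: He.
  by exists e => // y xy; apply: He; rewrite -ball_normE.
- move=> u cu; have /cauchy_cvgP cvu : cauchy (u @ \oo); last by exists (lim (u @ \oo)).
  apply/cauchy_ballP => e e0; have [N HN] := cu e e0.
  rewrite near_map2; exists ([set n | (N <= n)%N], [set n | (N <= n)%N]).
    by split; exact: nbhs_infty_ge.
  by move=> [m n] [/= Hm Hn]; rewrite -ball_normE; exact: HN.
Qed.

End Action.

(** * The equidecomposition *)

(** The pieces are the fibres of [lab], finitely many because the labels lie in [s]. *)
Lemma equidecomposable_of_labelling (G : groupType) (X : Type)
    (act : G -> X -> X) (A B : set X) (lab : X -> G) (s : seq G) :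
  (forall x, A x -> lab x \in s) -> set_bij A B (fun x => act (lab x) x) ->
  equidecomposable act A B.
Proof.
move=> labs [funAB injAB surjAB].
(* Labels that do not occur are dropped since pieces must be nonempty, repetitions so that different
   indices give disjoint fibres. *)
pose s' := [seq g <- undup s | `[< exists2 x, A x & lab x = g >]].
have us' : uniq s' by rewrite filter_uniq// undup_uniq.
have labs' x : A x -> lab x \in s'.
  move=> Ax; rewrite mem_filter mem_undup labs// andbT.
  by apply/asboolP; exists x.
pose alpha (i : 'I_(size s')) := nth 1%g s' i.
have alpha_inj i j : alpha i = alpha j -> i = j.
  by move=> /eqP; rewrite nth_uniq// => /eqP/val_inj.
have lab_alpha x : A x -> exists i, lab x = alpha i.
  move=> Ax; have h : (index (lab x) s' < size s')%N by rewrite index_mem labs'.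
  by exists (Ordinal h); rewrite /alpha nth_index// labs'.
exists (size s'), (fun i => [set x | A x /\ lab x = alpha i]), alpha; split=> //.
- split.
  + apply/seteqP; split=> [x [i _ []]//|x Ax].
    by have [i xi] := lab_alpha x Ax; exists i.
  + by move=> i j _ _ [x [[_ xi] [_ xj]]]; apply: alpha_inj; rewrite -xi.
  + move=> i _; have : alpha i \in s' by rewrite mem_nth.
    by rewrite mem_filter => /andP[/asboolP[x Ax xi] _]; exists x.
- move=> i j _ _ [_ [[x [Ax xi] <-] [y [Ay yj]]]].
  rewrite -xi -yj => /injAB; rewrite !inE => /(_ Ay Ax) xy.
  by apply: alpha_inj; rewrite -xi -yj xy.
- apply/seteqP; split=> [y|y [i _ [x [Ax xi] <-]]].
  + move=> /surjAB[x Ax <-]; have [i xi] := lab_alpha x Ax.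
    by exists i => //; exists x => //; rewrite xi.
  + by rewrite -xi; exact: funAB.
Qed.

Section Equidecomposition.
Variable R : realType.
Local Notation alpha := (@alpha R).
Implicit Types (x y : R) (g h : dihedral).

(** The equation says that the reflection [(true, n)] fixes [x] modulo 1. *)
Definition exceptional x := exists m n : int, 2 * x = m%:~R + n%:~R * alpha.

Lemma exceptional_countable : countable exceptional.
Proof.
pose f (p : int * int) : R := (p.1%:~R + p.2%:~R * alpha) / 2.
apply: (@sub_countable _ _ _ (f @` setT)); last first.
  apply: sub_countable (countableP [set: int * int]); exact: card_image_le.
apply: subset_card_le => x [m [n mn]]; exists (m, n) => //.
by rewrite /f /= -mn; field.
Qed.

Lemma exceptionalDz x (m : int) : exceptional (x + m%:~R) <-> exceptional x.
Proof.
suff H y (k : int) : exceptional y -> exceptional (y + k%:~R).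
  split=> [/(H _ (- m))|]; last exact: H.
  by rewrite intrN addrK.
move=> [a [b ab]]; exists (a + 2 * k), b.
by rewrite intrD intrM mulrDr ab; ring.
Qed.

Lemma exceptional_affine g x : exceptional (affine g x) <-> exceptional x.
Proof.
suff H h y : exceptional y -> exceptional (affine h y).
  split=> [/(H g^-1%g)|]; last exact: H.
  by rewrite affineK.
case: h => e k [a [b ab]]; exists ((-1) ^+ e * a), ((-1) ^+ e * b + 2 * k).
rewrite /affine /= mulrDr mulrCA ab intrD !intrM intr_sign.
by ring.
Qed.

Lemma exceptional_frac x : exceptional (frac x) <-> exceptional x.
Proof. by have [m ->] := fracE x; exact: exceptionalDz. Qed.

Definition generic : set R := [set x | 0 <= x < 1 /\ ~ exceptional x].

Lemma generic_act g x : generic x -> generic (act g x).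
Proof.
move=> [x01 nx]; split; first exact: act_itv.
by rewrite actE// exceptional_frac exceptional_affine.
Qed.

Lemma generic_frac x : ~ exceptional x -> generic (frac x).
Proof. by move=> nx; split; [exact: frac_itv|rewrite exceptional_frac]. Qed.

Lemma reflection_not_fixed n x : generic x -> act (true, n) x <> x.
Proof.
move=> [x01 nx]; rewrite actE//.
have [m ->] := fracE (affine (true, n) x); rewrite /affine /= expr1 => H.
by apply: nx; exists m, n; move: H => /(congr1 (fun z => z + x)); rewrite -[2]/(1 + 1); lra.
Qed.

(** Choice fixes a base point [r x] in each orbit, and [M x] tells whether a reflection carries it
    to [x]. This is unambiguous on generic points, which no reflection fixes. *)
Lemma orientation_exists : exists M : R -> bool,
  forall g x, generic x -> M (act g x) = g.1 (+) M x.
Proof.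
pose orb x := [set y | exists g, y = act g x].
have orbact g x : orb (act g x) = orb x.
  apply/seteqP; split=> [y [h ->]|y [h ->]]; first by exists (h * g)%g; rewrite actM.
  by exists (h * g^-1)%g; rewrite -actM -mulgA mulVg mulg1.
(* Points of one orbit have equal sets [orb x], hence the same base point. *)
pose r x := get (orb x).
have rP x : exists g, x = act g (r x).
  have [g E] : orb x (r x) by apply: (getI (x := x)); exists 1%g; rewrite act1.
  by exists g^-1%g; rewrite E -actM mulVg act1.
exists (fun x => `[< exists n, x = act (true, n) (r x) >]) => g x gx.
have [g0 E] := rP x.
have gr : generic (r x).
  have -> : r x = act g0^-1%g x by rewrite E -actM mulVg act1 -E.
  exact: generic_act.
have rg : r (act g x) = r x by rewrite /r orbact.
have key h : `[< exists n, act h (r x) = act (true, n) (r x) >] = h.1.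
  apply/asboolP/idP; last by case: h => [[] n]// _; exists n.
  (* A rotation and a reflection agreeing at [r x] would differ by a reflection fixing [r x]. *)
  case: h => [[]//] k [n] /(congr1 (act ((true, n) : dihedral)^-1%g)).
  rewrite -!actM mulVg act1 => H.
  case: (@reflection_not_fixed (- (-1) ^+ true * n + (-1) ^+ true * k) (r x) gr).
  by rewrite -[RHS]H.
rewrite rg {1}E -actM key [in RHS]E.
have -> : r (act g0 (r x)) = r x by rewrite -E.
by rewrite key.
Qed.

Definition refl_a : dihedral := (true, 0).
Definition refl_b : dihedral := (true, 1).

Definition half_a x := x < 1 / 2.
Definition half_b x := (alpha / 2 < x) && (x < (alpha + 1) / 2).

(** On (0, 1) the reflection is 1 - x and swaps the sides of 1/2; the points 0 and 1/2 are
    exceptional. *)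
Lemma half_a_refl x : generic x -> half_a (act refl_a x) = ~~ half_a x.
Proof.
move=> [x01 nx].
have x0 : x != 0 by apply/eqP => E; apply: nx; exists 0, 0; rewrite E; ring.
have xgt0 : 0 < x by rewrite lt_neqAle eq_sym x0; case/andP: x01.
have xh : x != 1 / 2 by apply/eqP => E; apply: nx; exists 1, 0; rewrite E; field.
rewrite actE//.
have -> : frac (affine refl_a x) = 1 - x.
  have -> : affine refl_a x = (1 - x) + (-1)%:~R by rewrite /affine /=; ring.
  by rewrite fracDz frac_id//; lra.
by rewrite /half_a -leNgt; move: xh; rewrite neq_lt => /orP xh;
  apply/idP/idP => h; case: xh => xh; lra.
Qed.

(** On [0, 1) the reflection is alpha - x up to alpha and 1 + alpha - x beyond; its fixed points are
    the two ends of the half circle. *)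
Lemma half_b_refl x : generic x -> half_b (act refl_b x) = ~~ half_b x.
Proof.
move=> [x01 nx]; have a0 := alpha_gt0 R; have a2 := alpha_lt_half R.
have x0 : x != alpha / 2 by apply/eqP => E; apply: nx; exists 0, 1; rewrite E; field.
have xh : x != (alpha + 1) / 2 by apply/eqP => E; apply: nx; exists 1, 1; rewrite E; field.
rewrite actE//.
have [xa|xa] := leP x alpha.
- have -> : frac (affine refl_b x) = alpha - x.
    have -> : affine refl_b x = alpha - x by rewrite /affine /=; ring.
    by rewrite frac_id//; lra.
  rewrite /half_b negb_and -!leNgt; move: x0 xh; rewrite !neq_lt => x0 xh.
  by apply/idP/idP; lra.
- have -> : frac (affine refl_b x) = 1 + alpha - x.
    have -> : affine refl_b x = (1 + alpha - x) + (-1)%:~R by rewrite /affine /=; ring.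
    by rewrite fracDz frac_id//; lra.
  rewrite /half_b negb_and -!leNgt; move: x0 xh; rewrite !neq_lt => x0 xh.
  by apply/idP/idP; lra.
Qed.

Definition half_set (P : R -> bool) : set R := [set x | generic x /\ P x].

Lemma half_set_borel (P : R -> bool) : measurable [set x | P x] -> borel (half_set P).
Proof.
move=> mP; rewrite borelE.
have -> : half_set P = (`[0, 1[ `\` exceptional) `&` [set x | P x].
  apply/seteqP; split=> x.
    by move=> [[x01 nx] Px]; split=> //; split=> //=; rewrite in_itv.
  by move=> [[/= + nx] Px]; rewrite in_itv.
apply: measurableI => //; apply: measurableD; first exact: measurable_itv.
apply: countable_measurable; last exact: exceptional_countable.
exact: measurable_set1.
Qed.

Lemma half_a_borel : borel (half_set half_a).
Proof.
apply: half_set_borel; have -> : [set x | half_a x] = `]-oo, (1/2)[%classic.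
  by apply/seteqP; split=> x /=; rewrite in_itv.
exact: measurable_itv.
Qed.

Lemma half_b_borel : borel (half_set half_b).
Proof.
apply: half_set_borel.
have -> : [set x | half_b x] = `](alpha / 2), ((alpha + 1) / 2)[%classic.
  by apply/seteqP; split=> x /=; rewrite in_itv.
exact: measurable_itv.
Qed.

(** The multiplier that carries [x] to the member of {x, c x} selected by [P]. *)
Definition flip (P : R -> bool) (c : dihedral) x : dihedral :=
  if P x then 1%g else c.

Definition transversal (c : dihedral) (P : R -> bool) :=
  forall x, generic x -> P (act c x) = ~~ P x.

Lemma act_flip_flip c P Q x : (c * c = 1)%g -> transversal c P -> transversal c Q ->
  generic x -> P x ->
  Q (act (flip Q c x) x) /\
  act (flip P c (act (flip Q c x) x)) (act (flip Q c x) x) = x.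
Proof.
move=> cc tP tQ gx Px; have [Qx|Qx] := boolP (Q x).
  by rewrite /flip Qx act1 Px act1.
have -> : flip Q c x = c by rewrite /flip (negbTE Qx).
have -> : flip P c (act c x) = c by rewrite /flip tP// Px.
by rewrite -actM cc act1 tQ.
Qed.

(** Both sets meet every generic pair {x, c x} in one point; exchanging [P] and [Q] gives the
    inverse. *)
Lemma half_set_bij c P Q : (c * c = 1)%g -> transversal c P -> transversal c Q ->
  set_bij (half_set P) (half_set Q) (fun x => act (flip Q c x) x).
Proof.
move=> cc tP tQ; split.
- move=> x [gx Px]; split; first exact: generic_act.
  by have [] := act_flip_flip cc tP tQ gx Px.
- move=> x y; rewrite !inE => -[gx Px] [gy Py] xy.
  have [_ Ex] := act_flip_flip cc tP tQ gx Px.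
  have [_ Ey] := act_flip_flip cc tP tQ gy Py.
  by move: xy => /= xy; rewrite -[LHS]Ex -[RHS]Ey xy.
- move=> y [gy Qy]; exists (act (flip P c y) y).
    by have [] := act_flip_flip cc tQ tP gy Qy; split=> //; exact: generic_act.
  by have [] := act_flip_flip cc tQ tP gy Qy.
Qed.

Lemma halves_equidecomposable :
  equidecomposable (@act R) (half_set half_a) (half_set half_b).
Proof.
have [M HM] := orientation_exists.
have Ma : transversal refl_a M by move=> x gx; rewrite HM.
have Mb : transversal refl_b M by move=> x gx; rewrite HM.
have bij1 := half_set_bij (erefl : refl_a * refl_a = 1)%g half_a_refl Ma.
have bij2 := half_set_bij (erefl : refl_b * refl_b = 1)%g Mb half_b_refl.
(* The second move is read off at the intermediate point, not at [x]. *)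
pose lab x := (flip half_b refl_b (act (flip M refl_a x) x) * flip M refl_a x)%g.
apply: (@equidecomposable_of_labelling _ _ _ _ _ lab
    [:: 1; refl_a; refl_b; refl_b * refl_a]%g).
  move=> x _; rewrite /lab /flip !inE.
  by case: ifP => _; case: ifP => _; rewrite ?mul1g ?mulg1 eqxx ?orbT.
have -> : (fun x => act (lab x) x) =
    (fun x => act (flip half_b refl_b x) x) \o (fun x => act (flip M refl_a x) x).
  by apply/funext => x; rewrite /= /lab actM.
exact: set_bij_comp bij1 bij2.
Qed.

End Equidecomposition.

(** * Baire pieces *)

Section NotEquidecomposable.
Variable R : realType.
Local Notation alpha := (@alpha R).
Local Notation exceptional := (@exceptional R).
Implicit Types (x y : R) (g h : dihedral) (A B : set R) (phi psi : R -> bool).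

Lemma translation_continuous (c : R) : continuous (fun x => x + c).
Proof. by move=> x; apply: cvgD; [exact: cvg_id|exact: cvg_cst]. Qed.

Definition tame phi :=
  (forall x (m : int), phi (x + m%:~R) = phi x) /\ locally_decided phi.

Lemma tame_cst b : tame (fun=> b).
Proof. by split=> //; exact: locally_decided_cst. Qed.

Lemma tame_addb phi psi : tame phi -> tame psi -> tame (fun x => phi x (+) psi x).
Proof.
move=> [p1 d1] [p2 d2]; split=> [x m|]; first by rewrite p1 p2.
exact: locally_decided_addb.
Qed.

Lemma tame_affine g phi : tame phi -> tame (fun x => phi (affine g x)).
Proof.
move=> [p d]; split=> [x m|]; first by rewrite affineDz p.
apply: (@locally_decided_comp _ (affine g) (affine g^-1%g)) d.
- exact: affineK.
- exact: affineVK.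
- exact: affine_continuous.
- exact: affine_continuous.
Qed.

Lemma affine_opp x : affine (true, 0) x = - x.
Proof. by rewrite /affine /=; ring. Qed.

Lemma affine_shift (n : int) x : affine (false, n) x = x + n%:~R * alpha.
Proof. by rewrite /affine /=; ring. Qed.

Lemma affine_reflS x : affine (true, -1) x = - x - alpha.
Proof. by rewrite /affine /=; ring. Qed.

Definition lift A x := `[< A (frac x) >].

(** On each interval (m, m + 1) the lift is a translate of [A]. *)
Lemma tame_lift A : baire_property A -> tame (lift A).
Proof.
move=> /baire_property_locally_decided dA; split=> [x m|]; first by rewrite /lift fracDz.
move=> U oU [x Ux]; set m : R := (Num.floor x)%:~R.
have /= : nbhs x U by exact: open_nbhs_nbhs.
move=> /nbhs_ballP[e /= e0 He].
have fx := frac_itv x; have fE : frac x = x - m by [].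
have dm : locally_decided (fun y => `[< A (y - m) >]).
  apply: (@locally_decided_comp _ (fun y => y - m) (fun y => y + m)) dA.
  - by move=> y; rewrite subrK.
  - by move=> y; rewrite addrK.
  - exact: translation_continuous.
  - exact: translation_continuous.
have [||V [oV V0 VU [b mb]]] := dm (U `&` `]m, (m + 1)[).
- by apply: openI => //; exact: interval_open.
(* [x] may be the left end [m], so a point slightly to its right is taken, still in the ball and
   below [m + 1]. *)
- pose d := Num.min e (1 - frac x).
  have d0 : 0 < d by rewrite lt_min e0; lra.
  have [de dx] : d <= e /\ d <= 1 - frac x by rewrite !ge_min !lexx orbT.
  exists (x + d / 2); split; last by rewrite /= in_itv /=; lra.
  apply: He; rewrite -ball_normE /=.
  have -> : x - (x + d / 2) = - (d / 2) by ring.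
  by rewrite normrN gtr0_norm; lra.
exists V; split=> //; first by move=> y /VU[].
exists b; apply: sub_meager mb => y [Vy Ey]; split=> //; rewrite -Ey.
have /VU[_] := Vy; rewrite /= in_itv /= => my.
congr (`[< A _ >]).
by rewrite -(@frac_id _ (y - m)) /m -?intrN ?fracDz// intrN -/m; lra.
Qed.

Lemma lift_act g A : A `<=` [set x | 0 <= x < 1] ->
  lift (act g @` A) = (fun x => lift A (affine g^-1%g x)).
Proof.
move=> A01; apply/funext => x; apply/asbool_equiv_eq; split.
- move=> [y Ay]; rewrite actE ?A01// => E.
  have -> : frac (affine g^-1%g x) = y; last by [].
  rewrite -frac_affine_frac -E frac_affine_frac affineK frac_id//.
  exact: A01.
- move=> Ay; exists (frac (affine g^-1%g x)) => //.
  by rewrite actE ?frac_itv// frac_affine_frac affineVK.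
Qed.

(** By disjointness at most one summand is true, so the union is a sum modulo 2, compatible with
    folds. *)
Lemma lift_trivIset n (A : 'I_n -> set R) : trivIset setT A ->
  lift (\bigcup_i A i) = (fun x => \big[addb/false]_i lift (A i) x).
Proof.
move=> tA; apply/funext => x; rewrite /lift.
have [[j _ Aj]|nA] := pselect ((\bigcup_i A i) (frac x)).
- rewrite asboolT; last by exists j.
  rewrite (bigD1 j)//= asboolT// big1// => i ij; apply/asboolPn => Ai.
  by move/eqP: ij; apply; apply: tA => //; exists (frac x).
- rewrite asboolF// big1// => i _; apply/asboolPn => Ai.
  by apply: nA; exists i.
Qed.

(** * Folds and cohomology *)

Definition fold phi x := phi x (+) phi (- x).

Lemma fold_addb phi psi x :
  fold (fun y => phi y (+) psi y) x = fold phi x (+) fold psi x.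
Proof. by rewrite /fold addbACA. Qed.

(* The symmetry of [psi] makes its fold the coboundary
   psi(x) (+) psi(x - alpha) of the rotation. *)
Definition cohomologous phi phi' := exists psi, [/\ tame psi,
  forall x, psi (- x - alpha) = psi x &
  forall x, fold psi x = fold phi x (+) fold phi' x].

Lemma cohomologous_eq_fold phi phi' : fold phi =1 fold phi' -> cohomologous phi phi'.
Proof.
move=> E; exists (fun=> false); split=> // [|x]; first exact: tame_cst.
by rewrite E addbb.
Qed.

Lemma cohomologous_sym phi phi' : cohomologous phi phi' -> cohomologous phi' phi.
Proof. by move=> [psi [t s e]]; exists psi; split=> // x; rewrite e addbC. Qed.

Lemma cohomologous_trans phi1 phi2 phi3 :
  cohomologous phi1 phi2 -> cohomologous phi2 phi3 -> cohomologous phi1 phi3.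
Proof.
move=> [psi [t s e]] [psi' [t' s' e']].
exists (fun x => psi x (+) psi' x); split=> [|x|x]; first exact: tame_addb.
- by rewrite s s'.
- by rewrite fold_addb e e' addbA addbK.
Qed.

Lemma cohomologous_addb phi1 phi1' phi2 phi2' :
  cohomologous phi1 phi1' -> cohomologous phi2 phi2' ->
  cohomologous (fun x => phi1 x (+) phi2 x) (fun x => phi1' x (+) phi2' x).
Proof.
move=> [psi [t s e]] [psi' [t' s' e']].
exists (fun x => psi x (+) psi' x); split=> [|x|x]; first exact: tame_addb.
- by rewrite s s'.
- by rewrite !fold_addb e e' addbACA.
Qed.

Lemma cohomologous_big n (F G : 'I_n -> R -> bool) :
  (forall i, cohomologous (F i) (G i)) ->
  cohomologous (fun x => \big[addb/false]_i F i x) (fun x => \big[addb/false]_i G i x).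
Proof.
move=> FG; elim: (index_enum 'I_n) => [|i s IH].
  by apply: cohomologous_eq_fold => x; rewrite /fold !big_nil.
have H (K : 'I_n -> R -> bool) : (fun x => \big[addb/false]_(j <- i :: s) K j x) =
    (fun x => K i x (+) \big[addb/false]_(j <- s) K j x).
  by apply/funext => x; rewrite big_cons.
by rewrite !H; exact: cohomologous_addb.
Qed.

Lemma tame_shift phi (n : int) : tame phi -> tame (fun x => phi (x + n%:~R * alpha)).
Proof.
have -> : (fun x => phi (x + n%:~R * alpha)) = (fun x => phi (affine (false, n) x)).
  by apply/funext => x; rewrite affine_shift.
exact: tame_affine.
Qed.

(** The map x |-> -x - alpha exchanges the two terms of the witness, whose fold collects the four
    terms of the folds of [phi] and its shift. *)
Lemma cohomologous_shift1 phi : tame phi -> cohomologous phi (fun x => phi (x + alpha)).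
Proof.
move=> tphi; exists (fun x => phi (x + alpha) (+) phi (- x)); split.
- apply: tame_addb.
    by have := tame_shift 1 tphi; under eq_fun do rewrite mul1r.
  by have := tame_affine (true, 0) tphi; under eq_fun do rewrite affine_opp.
- move=> x /=; rewrite addbC; congr (phi _ (+) phi _); ring.
- move=> x; rewrite /fold opprK; move: (phi _) (phi _) (phi _) (phi _).
  by move=> [] [] [] [].
Qed.

Lemma cohomologous_shift phi (n : int) :
  tame phi -> cohomologous phi (fun x => phi (x + n%:~R * alpha)).
Proof.
have nat_shift (k : nat) f : tame f -> cohomologous f (fun x => f (x + k%:~R * alpha)).
  move=> tf; elim: k => [|k IH].
    by apply: cohomologous_eq_fold => x; rewrite /fold mul0r !addr0.
  apply: cohomologous_trans IH _.
  have -> : (fun x => f (x + k.+1%:~R * alpha)) = (fun x => f (x + alpha + k%:~R * alpha)).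
    by apply/funext => x; congr f; rewrite -addn1 PoszD intrD; ring.
  exact: (cohomologous_shift1 (tame_shift k tf)).
move=> tphi; have [n0|n0] := leP 0 n.
  by rewrite -(gez0_abs n0); exact: nat_shift.
(* For negative [n], [phi] is the shift by |n| alpha of its own shift by n alpha. *)
apply: cohomologous_sym.
have := nat_shift `|n|%N _ (tame_shift n tphi); congr cohomologous.
apply/funext => x; congr phi.
by rewrite -addrA -mulrDl ltz0_abs// -intrD addNr mul0r addr0.
Qed.

(** For a reflection, phi(-x + n alpha) has the same fold as the shift phi(x + n alpha). *)
Lemma cohomologous_affine g phi :
  tame phi -> cohomologous phi (fun x => phi (affine g x)).
Proof.
move=> tphi; case: g => -[] n.
- apply: cohomologous_trans (cohomologous_shift n tphi) _.
  apply: cohomologous_eq_fold => x; rewrite /fold addbC /affine /= expr1.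
  by rewrite mulrNN mulN1r mul1r.
- have -> : (fun x => phi (affine (false, n) x)) = (fun x => phi (x + n%:~R * alpha)).
    by apply/funext => x; rewrite affine_shift.
  exact: cohomologous_shift.
Qed.

Lemma lift_half_affine c P x : transversal c P -> ~ exceptional x ->
  lift (half_set P) (affine c x) = ~~ lift (half_set P) x.
Proof.
move=> tP nx; have gx := generic_frac nx.
have E y : generic (frac y) -> lift (half_set P) y = P (frac y).
  by move=> gy; apply/asboolP/idP => [[]//|Py]; split.
rewrite !E//; last by apply: generic_frac; rewrite exceptional_affine.
by rewrite -tP// actE ?frac_itv// frac_affine_frac.
Qed.

Lemma rotation_invariance phi (n : int) x :
  (forall y, ~ exceptional y -> phi (y + alpha) = phi y) ->
  ~ exceptional x -> phi (x + n%:~R * alpha) = phi x.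
Proof.
move=> inv.
have nat_shift (k : nat) y : ~ exceptional y -> phi (y + k%:~R * alpha) = phi y.
  move=> ny; elim: k => [|k IH]; first by rewrite mul0r addr0.
  rewrite -IH -[RHS]inv; last by rewrite -affine_shift exceptional_affine.
  by congr phi; rewrite -addn1 PoszD intrD; ring.
move=> nx; have [n0|n0] := leP 0 n; first by rewrite -(gez0_abs n0) nat_shift.
rewrite -(nat_shift `|n|%N); last by rewrite -affine_shift exceptional_affine.
by rewrite -addrA -mulrDl ltz0_abs// -intrD subrr mul0r addr0.
Qed.

(** On some open [V], [phi] avoids a value [b] up to a meager set. A reflection and a rotation send
    a common nonempty open set into [V], yet off exceptional points give opposite values of
    [phi]. *)
Lemma no_tame_antisymmetric_invariant phi : tame phi ->
  (forall x, ~ exceptional x -> phi (x + alpha) = phi x) ->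
  (forall x, ~ exceptional x -> phi (- x - alpha) = ~~ phi x) -> False.
Proof.
move=> [per dphi] inv anti.
have [||V [oV [v Vv] _ [b mb]]] := dphi setT.
- exact: openT.
- by exists 0.
have /nbhs_ballP[e /= e0 He] : nbhs v V by exact: open_nbhs_nbhs.
(* The reflection sends [w] to [v], and density gives [c] with [w + c] close to [v]. *)
pose w := - v - alpha.
have [m [n mn]] := alpha_dense (v - w) e0.
set c : R := m%:~R + n%:~R * alpha in mn.
pose r x := affine (true, -1) x.
pose t x := x + c.
have cr : continuous r by exact: affine_continuous.
have ct : continuous t by exact: translation_continuous.
have rK : cancel r r by move=> x; rewrite /r !affine_reflS; ring.
have mr := meager_preimage rK rK cr cr mb.
have mt : meager (t @^-1` [set x | V x /\ phi x = b]).
  apply: (@meager_preimage _ t (fun x => x - c)) mb => //.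
  - by move=> x; rewrite /t addrK.
  - by move=> x; rewrite /t subrK.
  - exact: translation_continuous.
have mW := meagerU (countable_meager (exceptional_countable R)) (meagerU mr mt).
apply: (@meager_not_open _ (r @^-1` V `&` t @^-1` V)).
- by apply: openI; exact: open_comp.
- exists w; split.
    by rewrite /= /r affine_reflS /w; have -> : - (- v - alpha) - alpha = v by ring.
  by apply: He; rewrite -ball_normE /= /t opprD addrA.
- apply: sub_meager mW => x [Vr Vt].
  have [nx|nx] := pselect (exceptional x); [by left|right].
  have tx : phi (t x) = phi x.
    (* Periodicity absorbs the summand [m] of [c], rotation invariance the multiple of [alpha]. *)
    rewrite /t /c addrCA addrC per addrC -[RHS](rotation_invariance n inv nx).
    by congr phi; ring.
  have rx : phi (r x) = ~~ phi x by rewrite /r affine_reflS anti.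
  have [E|E] := eqVneq (phi x) b; [right|left]; split=> //; first by rewrite tx.
  by rewrite rx; move: E; case: (phi x); case: (b).
Qed.

Lemma halves_not_equidecomposable_baire :
  ~ equidecomposable_baire (@act R) (half_set (@half_a R)) (half_set (@half_b R)).
Proof.
move=> [n [A [g [[covA tA _] bA tgA Bg]]]].
have A01 i : A i `<=` [set x | 0 <= x < 1].
  move=> x Ax; have : half_set (@half_a R) x by rewrite -covA; exists i.
  by move=> [[]].
(* Both lifts are sums over the pieces, resp. their images, and are compared term by term. *)
have [psi [tpsi sym E]] :
    cohomologous (lift (half_set (@half_a R))) (lift (half_set (@half_b R))).
  rewrite Bg -covA !lift_trivIset//; apply: cohomologous_big => i.
  by rewrite lift_act//; exact/cohomologous_affine/tame_lift.
(* Tameness is read off the decomposition: the lift is a sum of tame lifts composed with affine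
   maps. *)
have tame_b : tame (lift (half_set (@half_b R))).
  rewrite Bg lift_trivIset//.
  elim: (index_enum 'I_n) => [|i s IH].
    by have := tame_cst false; under [X in _ -> tame X]eq_fun do rewrite big_nil.
  under eq_fun do rewrite big_cons.
  apply: tame_addb IH; rewrite lift_act//; exact/tame_affine/tame_lift.
set L := lift (half_set (@half_b R)) in E tame_b *.
have Lopp x : ~ exceptional x -> L (- x) = ~~ L (x + alpha).
  move=> nx; have := lift_half_affine (@half_b_refl R) (x := - x).
  rewrite -affine_opp exceptional_affine => /(_ nx).
  have -> : affine refl_b (affine (true, 0) x) = x + alpha by rewrite /affine /=; ring.
  by rewrite -/L => ->; rewrite negbK.
(* The fold of the first half circle is constantly true here; this negation cancels the one from
   [Lopp]. *)
have step x : ~ exceptional x -> psi x (+) psi (- x) = L x (+) L (x + alpha).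
  move=> nx; have := E x; rewrite /fold Lopp//.
  have := lift_half_affine (@half_a_refl R) nx; rewrite affine_opp => -> ->.
  by rewrite addbN addbb /= addbN negbK.
pose phi x := psi x (+) L (x + alpha).
apply: (@no_tame_antisymmetric_invariant phi).
- apply: tame_addb tpsi _; have := tame_shift 1 tame_b.
  by under eq_fun do rewrite mul1r.
- move=> x nx; have nx' : ~ exceptional (x + alpha).
    by rewrite -[alpha]mul1r -(affine_shift 1) exceptional_affine.
  (* At [x + alpha], the symmetry turns psi(-x - alpha) into psi(x), and [step] becomes the
     invariance of [phi]. *)
  have := step _ nx'; rewrite opprD sym /phi.
  by move: (psi _) (psi _) (L _) (L _) => [] [] [] [].
- by move=> x nx; rewrite /phi sym subrK Lopp// addbN.
Qed.

End NotEquidecomposable.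

Theorem theorem5p2 (R : realType) :
  exists (G : groupType) (X : topologicalType) (act : G -> X -> X)
         (B0 B1 : set X),
    polish R X /\
    acts_by_borel_automorphisms act /\
    borel B0 /\ borel B1 /\
    equidecomposable act B0 B1 /\
    ~ equidecomposable_baire act B0 B1.
Proof.
exists dihedral, R, (@act R), (half_set (@half_a R)), (half_set (@half_b R)).
split; first exact: real_polish.
split; first exact: act_borel_automorphisms.
split; first exact: half_a_borel.
split; first exact: half_b_borel.
split; first exact: halves_equidecomposable.
exact: halves_not_equidecomposable_baire.
Qed.
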